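(* As formal power series in $q$, \[\sum_{\pi\in\mathcal{D}} (-1)^{\mathcal{E}(\pi)} q^{\mathcal{O}(\pi)} = (-q;q^2)_\infty,\qquad \sum_{\pi\in\mathcal{P}} (-1)^{\mathcal{E}(\pi)} q^{\mathcal{O}(\pi)} = \frac{1}{(q^2;q^2)_\infty}.\]
   Context: A partition $\pi=(\lambda_1,\lambda_2,\dots)$ is a finite non-increasing sequence of positive integers; the empty sequence is the unique partition of $0$. $\mathcal{P}$ is the set of all partitions and $\mathcal{D}$ the set of partitions into distinct parts. $\mathcal{O}(\pi)=\lambda_1+\lambda_3+\cdots$, $\mathcal{E}(\pi)=\lambda_2+\lambda_4+\cdots$. $(a;q)_\infty=\prod_{i\ge0}(1-aq^i)$. *)

(* Defs.v *)
From HB Require Import structures.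
From mathcomp Require Import all_boot all_order all_algebra.
From mathcomp Require Import boolp classical_sets cardinality fsbigop.

Set Implicit Arguments.
Unset Strict Implicit.
Unset Printing Implicit Defensive.

Import GRing.Theory.

Local Open Scope classical_set_scope.
Local Open Scope ring_scope.

Record fps (R : Type) := Fps { fcoef : nat -> R }.

Lemma fpsP (R : Type) (F G : fps R) : fcoef F =1 fcoef G <-> F = G.
Proof. by case: F G => [f] [g]; split=> [/= /funext ->|[->]]. Qed.

HB.instance Definition _ (R : Type) := gen_eqMixin (fps R).
HB.instance Definition _ (R : Type) := gen_choiceMixin (fps R).

Definition fps_zero (R : nzRingType) : fps R := Fps (fun _ => 0).
Definition fps_opp (R : nzRingType) (F : fps R) : fps R :=
  Fps (fun n => - fcoef F n).
Definition fps_add (R : nzRingType) (F G : fps R) : fps R :=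
  Fps (fun n => fcoef F n + fcoef G n).

Lemma fps_addA (R : nzRingType) : associative (@fps_add R).
Proof. by move=> F G H; apply/fpsP => n /=; rewrite addrA. Qed.
Lemma fps_addC (R : nzRingType) : commutative (@fps_add R).
Proof. by move=> F G; apply/fpsP => n /=; rewrite addrC. Qed.
Lemma fps_add0 (R : nzRingType) : left_id (fps_zero R) (@fps_add R).
Proof. by move=> F; apply/fpsP => n /=; rewrite add0r. Qed.
Lemma fps_addN (R : nzRingType) :
  left_inverse (fps_zero R) (@fps_opp R) (@fps_add R).
Proof. by move=> F; apply/fpsP => n /=; rewrite addNr. Qed.

HB.instance Definition _ (R : nzRingType) := GRing.isZmodule.Build (fps R)
  (@fps_addA R) (@fps_addC R) (@fps_add0 R) (@fps_addN R).

Definition fps_one (R : comNzRingType) : fps R := Fps (fun n => (n == 0%N)%:R).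
Definition fps_mul (R : comNzRingType) (F G : fps R) : fps R :=
  Fps (fun n => \sum_(i < n.+1) fcoef F i * fcoef G (n - i)).

Definition fps_trunc (R : comNzRingType) (N : nat) (F : fps R) : {poly R} :=
  \poly_(i < N) fcoef F i.

Lemma fps_mul_trunc (R : comNzRingType) (N n : nat) (F G : fps R) :
  (n < N)%N -> fcoef (fps_mul F G) n = (fps_trunc N F * fps_trunc N G)`_n.
Proof.
move=> ltnN; rewrite coefM; apply: eq_bigr => i _.
by rewrite !coef_poly !(leq_ltn_trans _ ltnN) ?leq_subr -1?ltnS.
Qed.

Lemma fps_mulA (R : comNzRingType) : associative (@fps_mul R).
Proof.
move=> F G H; apply/fpsP => n.
have trM A B i : (i <= n)%N ->
    (fps_trunc n.+1 (fps_mul A B))`_i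
    = (fps_trunc n.+1 A * fps_trunc n.+1 B)`_i.
  by move=> lein; rewrite coef_poly ltnS lein (@fps_mul_trunc _ n.+1).
rewrite !(@fps_mul_trunc _ n.+1) //.
transitivity (fps_trunc n.+1 F * (fps_trunc n.+1 G * fps_trunc n.+1 H))`_n.
  by rewrite !coefM; apply: eq_bigr => i _; rewrite trM ?leq_subr.
rewrite mulrA !coefM; apply: eq_bigr => i _; rewrite trM // -ltnS.
exact: ltn_ord.
Qed.

Lemma fps_mulC (R : comNzRingType) : commutative (@fps_mul R).
Proof.
by move=> F G; apply/fpsP => n; rewrite !(@fps_mul_trunc _ n.+1) // mulrC.
Qed.

Lemma fps_mul1 (R : comNzRingType) : left_id (fps_one R) (@fps_mul R).
Proof.
move=> F; apply/fpsP => n /=; rewrite big_ord_recl /= mul1r subn0 big1 ?addr0 //.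
by move=> i _; rewrite mul0r.
Qed.

Lemma fps_mulDl (R : comNzRingType) :
  left_distributive (@fps_mul R) (@fps_add R).
Proof.
move=> F G H; apply/fpsP => n /=; rewrite -big_split /=.
by apply: eq_bigr => i _; rewrite mulrDl.
Qed.

Lemma fps_one_neq0 (R : comNzRingType) : fps_one R != 0.
Proof.
apply/eqP => /fpsP /(_ 0%N) /= /eqP; exact/negP/oner_neq0.
Qed.

HB.instance Definition _ (R : comNzRingType) :=
  GRing.Zmodule_isComNzRing.Build (fps R)
    (@fps_mulA R) (@fps_mulC R) (@fps_mul1 R) (@fps_mulDl R)
    (@fps_one_neq0 R).

Lemma fcoefD (R : comNzRingType) (F G : fps R) n :
  fcoef (F + G) n = fcoef F n + fcoef G n.
Proof. by []. Qed.

Lemma fcoefN (R : comNzRingType) (F : fps R) n : fcoef (- F) n = - fcoef F n.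
Proof. by []. Qed.

Lemma fcoef1 (R : comNzRingType) n : fcoef (1 : fps R) n = (n == 0%N)%:R.
Proof. by []. Qed.

Lemma fcoefM (R : comNzRingType) (F G : fps R) n :
  fcoef (F * G) n = \sum_(i < n.+1) fcoef F i * fcoef G (n - i).
Proof. by []. Qed.

Fixpoint fps_inv_seq (R : comUnitRingType) (F : fps R) (n : nat) : seq R :=
  if n is m.+1 then
    let s := fps_inv_seq F m in
    rcons s ((fcoef F 0)^-1
             * ((m == 0%N)%:R - \sum_(i < m) s`_i * fcoef F (m - i)))
  else [::].

Lemma size_fps_inv_seq (R : comUnitRingType) (F : fps R) n :
  size (fps_inv_seq F n) = n.
Proof. by elim: n => //= n IHn; rewrite size_rcons IHn. Qed.

Lemma nth_fps_inv_seq (R : comUnitRingType) (F : fps R) m n :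
  (n < m)%N -> (fps_inv_seq F m)`_n = (fps_inv_seq F n.+1)`_n.
Proof.
elim: m => // m IHm; rewrite ltnS leq_eqVlt => /predU1P[->//|ltnm].
by rewrite [LHS]/= nth_rcons size_fps_inv_seq ltnm IHm.
Qed.

Definition fps_unit (R : comUnitRingType) : {pred fps R} :=
  fun F => fcoef F 0 \is a GRing.unit.

Definition fps_inv (R : comUnitRingType) (F : fps R) : fps R :=
  if fps_unit F then Fps (fun n => (fps_inv_seq F n.+1)`_n) else F.

Lemma fps_mulV (R : comUnitRingType) :
  {in @fps_unit R, left_inverse 1 (@fps_inv R) *%R}.
Proof.
move=> F uF; have uF0 : fcoef F 0 \is a GRing.unit by [].
have -> : fps_inv F = Fps (fun n => (fps_inv_seq F n.+1)`_n).
  by rewrite /fps_inv /fps_unit uF0.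
apply/fpsP => n; rewrite fcoefM big_ord_recr /= subnn.
rewrite nth_rcons size_fps_inv_seq ltnn eqxx mulrAC mulVr // mul1r.
under eq_bigr => i _ do rewrite -[rcons _ _]/(fps_inv_seq F i.+1)
  -(nth_fps_inv_seq F (ltn_ord i)).
by rewrite addrC subrK.
Qed.

Lemma fps_unitPl (R : comUnitRingType) (F G : fps R) :
  G * F = 1 -> fps_unit F.
Proof.
move=> /fpsP /(_ 0%N); rewrite fcoefM big_ord1 => GF.
by apply/unitrP; exists (fcoef G 0); rewrite [_ * fcoef G 0]mulrC.
Qed.

Lemma fps_inv_out (R : comUnitRingType) :
  {in [predC @fps_unit R], @fps_inv R =1 id}.
Proof.
move=> F /negbTE uF; have {}uF : fps_unit F = false by [].
by rewrite /fps_inv uF.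
Qed.

HB.instance Definition _ (R : comUnitRingType) :=
  GRing.ComNzRing_hasMulInverse.Build (fps R)
    (@fps_mulV R) (@fps_unitPl R) (@fps_inv_out R).

Definition fpsX (R : comNzRingType) : fps R := Fps (fun n => (n == 1%N)%:R).

(* F is summable over D when each power of q receives a nonzero contribution
   from finitely many indices only; this is what makes fps_sum meaningful,
   as \sum_(i \in D) is 0 on infinite supports. *)
Definition fps_summable (R : nzRingType) (I : choiceType) (D : set I)
    (F : I -> fps R) : Prop :=
  forall n, finite_set [set i | D i /\ fcoef (F i) n <> 0].

Definition fps_sum (R : nzRingType) (I : choiceType) (D : set I)
    (F : I -> fps R) : fps R :=
  Fps (fun n => \sum_(i \in D) fcoef (F i) n).

(* Convergence for the q-adic topology (R being discrete). *)
Definition fps_cvg (R : Type) (u : nat -> fps R) (L : fps R) : Prop :=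
  forall n, exists N, forall m, (N <= m)%N -> fcoef (u m) n = fcoef L n.

Definition fps_lim (R : nzRingType) (u : nat -> fps R) : fps R :=
  xget 0 [set L | fps_cvg u L].

Lemma fps_cvg_lim (R : nzRingType) (u : nat -> fps R) (L : fps R) :
  fps_cvg u L -> fps_lim u = L.
Proof.
move=> uL; apply: xget_unique => // L' uL'; apply/fpsP => n.
have [N uN] := uL n; have [N' uN'] := uL' n.
by rewrite -(uN (maxn N N')) ?leq_maxl // -(uN' (maxn N N')) ?leq_maxr.
Qed.

Definition qpoch (R : comNzRingType) (a q : fps R) (n : nat) : fps R :=
  \prod_(i < n) (1 - a * q ^+ i).

(* (a; q)_oo *)
Definition qpoch_inf (R : comNzRingType) (a q : fps R) : fps R :=
  fps_lim (qpoch a q).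

Lemma fcoef_exp_small (R : comNzRingType) (q : fps R) i n :
  fcoef q 0 = 0 -> (n < i)%N -> fcoef (q ^+ i) n = 0.
Proof.
move=> q0; elim: i n => // i IHi n; rewrite ltnS => leni.
rewrite exprS fcoefM big1 // => -[[|j] ltj] _ /=; first by rewrite q0 mul0r.
by rewrite IHi ?mulr0 //; case: n leni ltj => // n leni _; rewrite subSS
  (leq_ltn_trans (leq_subr _ _)).
Qed.

Lemma qpoch_cvg (R : comNzRingType) (a q : fps R) :
  fcoef q 0 = 0 -> fps_cvg (qpoch a q) (qpoch_inf a q).
Proof.
move=> q0; pose L := Fps (fun n => fcoef (qpoch a q n.+1) n).
suff uL : fps_cvg (qpoch a q) L by rewrite /qpoch_inf (fps_cvg_lim uL).
move=> n; exists n.+1 => m /subnKC <-; elim: (m - n.+1)%N => [|k IHk].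
  by rewrite addn0.
rewrite addnS.
have -> : qpoch a q (n.+1 + k).+1
    = qpoch a q (n.+1 + k) - qpoch a q (n.+1 + k) * a * q ^+ (n.+1 + k).
  by rewrite {1}/qpoch big_ord_recr /= -/(qpoch a q _) mulrBr mulr1 mulrA.
rewrite fcoefD fcoefN IHk fcoefM big1 ?subr0 // => i _.
by rewrite fcoef_exp_small ?mulr0 // addSn ltnS (leq_trans (leq_subr _ _))
  ?leq_addr.
Qed.

Lemma qpoch_inf_unit (R : comUnitRingType) (a q : fps R) :
  fcoef a 0 = 0 -> fcoef q 0 = 0 -> qpoch_inf a q \is a GRing.unit.
Proof.
move=> a0 q0; have [N /(_ N (leqnn N)) E] := qpoch_cvg a q0 0.
have L0 : fcoef (qpoch_inf a q) 0 = 1.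
  rewrite -E /qpoch; elim: {E} N => [|N IHN]; first by rewrite big_ord0.
  rewrite big_ord_recr fcoefM big_ord1 IHN mul1r fcoefD fcoefN fcoefM.
  by rewrite big_ord1 a0 mul0r subr0.
by change (fcoef (qpoch_inf a q) 0 \is a GRing.unit); rewrite L0 unitr1.
Qed.

Definition partitions : set (seq nat) :=
  [set s | sorted geq s /\ all (leq 1) s].

Definition distinct_partitions : set (seq nat) :=
  [set s | partitions s /\ uniq s].

(* nth counts from 0, so the parts of odd rank lambda_1, lambda_3, ...
   are those at even positions. *)
Definition odd_sum (s : seq nat) : nat :=
  (\sum_(i < size s | ~~ odd i) nth 0 s i)%N.

Definition even_sum (s : seq nat) : nat :=
  (\sum_(i < size s | odd i) nth 0 s i)%N.

(* Main.v *)
Require Import Defs.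
From mathcomp Require Import all_boot all_order all_algebra.
From mathcomp Require Import boolp classical_sets cardinality fsbigop.
From mathcomp Require Import zify ring.
Import GRing.Theory.
Local Open Scope ring_scope.

(** Fix the parts of odd rank [l1 >= l3 >= l5 >= ...]. The parts of even rank
    then range independently over intervals, [l3 <= l2 <= l1] and so on (strict
    inequalities for distinct parts), and the alternating sum of [(-1)^k] over
    such an interval vanishes unless its endpoints have the same parity. Only
    the partitions whose parts of odd rank are all even (all odd and distinct,
    in the distinct case) survive, with sign [+1]. In terms of the generating
    function [A N] of the partitions with largest part at most [N], splitting
    off the first two parts gives
      [A N = 1 + \sum_(1 <= m <= N) q^m \sum_(0 <= k <= m) (-1)^k A k],
    and [A (2j) = A (2j+1)] makes the inner sum telescope; the finite products
    [1/(q^2;q^2)_(N/2)] solve this recursion, and their limits are the claimed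
    series. *)

(** * Sums over the parts of odd and even rank, and partitions as chains *)

Lemma odd_sum_cons m p : odd_sum (m :: p) = (m + even_sum p)%N.
Proof.
rewrite /odd_sum /even_sum /= big_mkcond big_ord_recl /=; congr (_ + _)%N.
by rewrite [RHS]big_mkcond; apply: eq_bigr => i _; rewrite /bump /= negbK.
Qed.

Lemma even_sum_cons m p : even_sum (m :: p) = odd_sum p.
Proof.
rewrite /odd_sum /even_sum /= big_mkcond big_ord_recl /= add0n.
by rewrite [RHS]big_mkcond; apply: eq_bigr => i _; rewrite /bump.
Qed.

Lemma odd_sum_nil : odd_sum [::] = 0%N.
Proof. by rewrite /odd_sum big_ord0. Qed.

Lemma even_sum_nil : even_sum [::] = 0%N.
Proof. by rewrite /even_sum big_ord0. Qed.

(* [s] selects strictly decreasing ([true]) or weakly decreasing ([false])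
   sequences. *)
Definition is_part (s : bool) (p : seq nat) : bool :=
  sorted [rel x y | y + s <= x]%N p && all (leq 1) p.

Lemma is_part_cons s m p :
  is_part s (m :: p) = [&& 0 < m, head 0 p + s <= m & is_part s p]%N.
Proof. by rewrite /is_part; case: p => [|k p] /=; case: s; lia. Qed.

Lemma partitionsE p : partitions p <-> is_part false p.
Proof.
rewrite /partitions /is_part /=.
have -> : sorted [rel x y | y + false <= x]%N p = sorted geq p.
  by apply: eq_sorted => x y /=; rewrite addn0.
by split=> [[-> ->]|/andP[]].
Qed.

Lemma distinct_partitionsE p : distinct_partitions p <-> is_part true p.
Proof.
rewrite /distinct_partitions /partitions /is_part /=.
have -> : sorted [rel x y | y + true <= x]%N p = sorted gtn p.
  by apply: eq_sorted => x y /=; rewrite addn1.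
rewrite gtn_sorted_uniq_geq.
by split=> [[[-> ->] ->]|/andP[/andP[-> ->] ->]].
Qed.

Lemma head_le_odd_sum p : (head 0 p <= odd_sum p)%N.
Proof. by case: p => // m p; rewrite odd_sum_cons leq_addr. Qed.

(** * Enumeration of the partitions with bounded largest part *)

Definition glue (x : nat * nat) (r : seq nat) : seq nat :=
  x.1 :: (if x.2 == 0%N then r else x.2 :: r).

Definition head_pairs (s : bool) (N : nat) : seq (nat * nat) :=
  [seq (m, k) | m <- index_iota 1 N.+1, k <- index_iota 0 (m - s).+1].

(* The partitions with largest part at most [N] and [odd_sum] equal to [n],
   provided [n <= f]; a missing second part is treated as [0]. *)
Fixpoint part_enum (s : bool) (f N n : nat) : seq (seq nat) :=
  if n == 0%N then [:: [::]] else
  if f is f'.+1 then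
    [seq glue x r | x <- head_pairs s (minn N n),
                    r <- part_enum s f' (x.2 - s) (n - x.1)]
  else [::].

Lemma mem_head_pairs s N (x : nat * nat) :
  (x \in head_pairs s N) = [&& 0 < x.1, x.1 <= N & x.2 <= x.1 - s]%N.
Proof.
case: x => m k; apply/allpairsPdep/idP => /=.
  by case=> m' [k' []]; rewrite !mem_index_iota => ? ? [-> ->]; lia.
by move=> H; exists m, k; rewrite !mem_index_iota; split=> //; lia.
Qed.

Lemma head_pairs_uniq s N : uniq (head_pairs s N).
Proof.
apply: allpairs_uniq_dep; first exact: iota_uniq.
  by move=> m _; exact: iota_uniq.
by move=> [m k] [m' k'] _ _ /= [-> ->].
Qed.

Lemma part_enum0 s f N : part_enum s f N 0 = [:: [::]].
Proof. by case: f. Qed.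

Lemma part_enumS s f N n : (0 < n)%N ->
  part_enum s f.+1 N n = [seq glue x r | x <- head_pairs s (minn N n),
                    r <- part_enum s f (x.2 - s) (n - x.1)].
Proof. by case: n. Qed.

(** The fuel [f] suffices because splitting off two parts lowers [odd_sum] by the largest part,
    which is positive. *)
Lemma mem_part_enum s f N n (p : seq nat) : (n <= f)%N ->
  (p \in part_enum s f N n) =
  [&& is_part s p, head 0 p <= N & odd_sum p == n]%N.
Proof.
have nil_sum q : is_part s q -> (odd_sum q == 0)%N = (q == [::]).
  case: q => [|m q]; first by rewrite odd_sum_nil.
  by rewrite is_part_cons odd_sum_cons => /and3P[]; case: m.
have enum0 g M q : (q \in part_enum s g M 0) =
    [&& is_part s q, head 0 q <= M & odd_sum q == 0]%N.
  rewrite part_enum0 inE; apply/eqP/and3P => [->|[pq _]].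
    by rewrite odd_sum_nil.
  by rewrite nil_sum // => /eqP.
elim: f N n p => [|f IH] N n p lenf.
  have -> : n = 0%N by lia.
  exact: enum0.
have [->|n0] := posnP n; first exact: enum0.
rewrite part_enumS //; apply/allpairsPdep/idP.
  case=> -[m k] [r []]; rewrite mem_head_pairs /= => xP.
  rewrite IH; last by lia.
  case/and3P => pr hr /eqP or; rewrite /glue /= => ->.
  case: eqP => [k0|k0].
    (* Without a second part, the bound [k - s] on the remaining parts is [0], so none remain. *)
    have r0 : r = [::].
      case: r pr hr {or} => // a r; rewrite is_part_cons /=; lia.
    rewrite r0 is_part_cons odd_sum_cons even_sum_nil.
    by move: or; rewrite r0 odd_sum_nil /= /is_part /=; case: (s) xP; lia.
  rewrite !is_part_cons odd_sum_cons even_sum_cons pr /=.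
  by case: (s) xP hr; lia.
case: p => [|m p]; first by rewrite odd_sum_nil; lia.
rewrite is_part_cons odd_sum_cons => /and3P[/and3P[m0 hp pp] /= mN].
case: p hp pp => [|k r] /= hp.
  rewrite even_sum_nil => _ mn; exists (m, 0%N), [::].
  rewrite mem_head_pairs IH /=; last by lia.
  by rewrite odd_sum_nil /is_part; split=> //=; lia.
rewrite is_part_cons even_sum_cons => /and3P[k0 hr pr] mn; exists (m, k), r.
rewrite mem_head_pairs IH /=; last by lia.
rewrite /glue /= pr; split; [lia|lia|].
by rewrite (negPf (lt0n_neq0 k0)).
Qed.

(** [glue] alone is not injective: for [k > 0] it sends [(m, 0)], [k :: r] and [(m, k)], [r] to the
    same list. On the enumerated data it is, since a zero second entry forces an empty rest. *)
Lemma part_enum_uniq s f N n : (n <= f)%N -> uniq (part_enum s f N n).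
Proof.
elim: f N n => [|f IH] N n lenf; first by have -> : n = 0%N by lia.
have [->|n0] := posnP n; first by rewrite part_enum0.
rewrite part_enumS //; apply: allpairs_uniq_dep; first exact: head_pairs_uniq.
  by move=> x; rewrite mem_head_pairs => xP; apply: IH; lia.
move=> [x r] [y t] /allpairsPdep[x' [r' [xP rP [ex er]]]].
move=> /allpairsPdep[y' [t' [yP tP [ey et]]]] /=.
subst x' y' r' t'.
rewrite mem_part_enum in rP; last by rewrite mem_head_pairs in xP; lia.
rewrite mem_part_enum in tP; last by rewrite mem_head_pairs in yP; lia.
case: x y xP yP rP tP => m k [m' k'] /= xP yP rP tP; rewrite /glue /= => -[<-].
have nil0 k1 d q : k1 = 0%N ->
    [&& is_part s q, head 0 q <= k1 - s & odd_sum q == d]%N -> q = [::].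
  by move=> ->; case: q => // a q; rewrite is_part_cons /=; lia.
case: eqP => [k0|k0]; case: eqP => [k0'|k0'].
- by move=> ->; rewrite k0 k0'.
- by rewrite (nil0 _ _ _ k0 rP).
- by rewrite (nil0 _ _ _ k0' tP).
- by case=> -> ->.
Qed.

(** * Generating functions and their recursion *)

Lemma fcoefXnM (R : comNzRingType) (m n : nat) (G : fps R) :
  fcoef (fpsX R ^+ m * G) n = if (m <= n)%N then fcoef G (n - m) else 0.
Proof.
have XM (H : fps R) k : fcoef (fpsX R * H) k = if k is j.+1 then fcoef H j else 0.
  rewrite fcoefM; case: k => [|k]; first by rewrite big_ord1 mul0r.
  rewrite big_ord_recl mul0r add0r big_ord_recl /= mul1r subn1 big1 ?addr0 //.
  by move=> i _; rewrite mul0r.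
elim: m n => [|m IH] n; first by rewrite mul1r subn0.
by rewrite exprS -mulrA XM; case: n => // n; rewrite IH.
Qed.

Lemma fcoef_sum (R : comNzRingType) (I : Type) (r : seq I) (F : I -> fps R) n :
  fcoef (\sum_(i <- r) F i) n = \sum_(i <- r) fcoef (F i) n.
Proof. exact: (big_morph (fun H : fps R => fcoef H n)). Qed.

Lemma fcoef_signM (R : comNzRingType) k n (G : fps R) :
  fcoef ((-1) ^+ k * G) n = (-1) ^+ k * fcoef G n.
Proof.
rewrite -signr_odd -[in RHS]signr_odd.
by case: (odd k); rewrite ?expr0 ?mul1r // expr1 !mulN1r.
Qed.

(* Here [m] is the largest part and [k] the second one, or [0] if there is none;
   the truncated [k - s] then bounds the third part correctly also for [k = 0]. *)
Definition part_gf_rec (R : comNzRingType) (s : bool) (A : nat -> fps R) : Prop :=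
  forall N, A N = 1 + \sum_(1 <= m < N.+1)
    fpsX R ^+ m * \sum_(0 <= k < (m - s).+1) (-1) ^+ k * A (k - s)%N.

(** The recursion determines [A]: as [m > 0], coefficient [n] on the left needs only lower ones on
    the right. It mirrors [part_enum], where gluing [(m, k)] adds [m] to [odd_sum] and [k] to
    [even_sum]. *)
Lemma sum_part_enum (R : comNzRingType) s (A : nat -> fps R) :
  part_gf_rec R s A -> forall f N n, (n <= f)%N ->
  \sum_(p <- part_enum s f N n) (-1) ^+ even_sum p = fcoef (A N) n.
Proof.
move=> recA.
have A0 N : fcoef (A N) 0 = 1.
  rewrite recA fcoefD fcoef1 eqxx fcoef_sum big_nat_cond big1 ?addr0 // => m.
  by case: m => // m _; rewrite fcoefXnM.
elim=> [|f IH] N n lenf.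
  have -> : n = 0%N by lia.
  by rewrite part_enum0 big_seq1 even_sum_nil A0.
have [->|n0] := posnP n; first by rewrite part_enum0 big_seq1 even_sum_nil A0.
rewrite part_enumS // big_allpairs_dep.
transitivity (\sum_(x <- head_pairs s (minn N n))
    (-1) ^+ x.2 * fcoef (A (x.2 - s)%N) (n - x.1)).
  apply: eq_big_seq => x; rewrite mem_head_pairs => xP.
  rewrite -IH; last by lia.
  rewrite big_distrr; apply: eq_big_seq => r /=.
  rewrite mem_part_enum; last by lia.
  case: x xP => m k /= xP rP; rewrite -exprD /glue even_sum_cons /=.
  case: eqP => [k0|k0]; last by rewrite odd_sum_cons.
  have -> : r = [::].
    by case: r rP => // a r; rewrite is_part_cons /=; lia.
  by rewrite k0 odd_sum_nil even_sum_nil.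
rewrite /head_pairs big_allpairs_dep [in RHS]recA fcoefD fcoef1 eqn0Ngt n0 add0r.
(* Terms with [m > n] are multiples of [q^m] and do not reach coefficient [n]. *)
rewrite fcoef_sum [RHS](@big_cat_nat _ _ _ (minn N n).+1) //; last by lia.
rewrite [X in _ = _ + X]big_nat_cond [X in _ = _ + X]big1 ?addr0; last first.
  by move=> m mP; rewrite fcoefXnM ifN //; lia.
apply: eq_big_nat => m mP; rewrite fcoefXnM ifT; last by lia.
by rewrite fcoef_sum; apply: eq_bigr => k _; rewrite fcoef_signM.
Qed.

(** The terms [2j] and [2j+1] cancel, so only an unpaired last term survives. *)
Lemma alternating_sum (R : pzRingType) (a : nat -> R) m :
  (forall j, a j.*2.+1 = a j.*2) ->
  \sum_(0 <= k < m) (-1) ^+ k * a k = if odd m then a m.-1 else 0.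
Proof.
move=> aE; elim: m => [|m IH]; first by rewrite big_geq.
rewrite big_nat_recr //= IH -signr_odd.
case: (boolP (odd m)) => om /=; last by rewrite mul1r add0r.
have [j ->] : exists j, m = j.*2.+1 by exists m./2; rewrite -[LHS]odd_double_half om.
by rewrite aE expr1 mulN1r subrr.
Qed.

(** Raising the bound to [N+1] adds nothing if [N+1] is even; if it is odd, it adds [q^(N+1)] times
    the old product, giving the new factor [1 + q^(N+1)]. *)
Lemma distinct_part_gf (R : comNzRingType) :
  part_gf_rec R true (fun N => qpoch (- fpsX R) (fpsX R ^+ 2) (uphalf N)).
Proof.
elim=> [|N IH]; first by rewrite big_geq // addr0 /qpoch big_ord0.
rewrite big_nat_recr //= addrA -IH.
rewrite (alternating_sum _ (fun k => qpoch _ _ (uphalf (k - true)))); last first.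
  (* Both [uphalf (2j)] and [uphalf (2j-1)] are [j], with truncated [0 - 1 = 0] when [j = 0]. *)
  by move=> j; congr (qpoch _ _ _); lia.
have -> : (N.+1 - true)%N = N by lia.
rewrite /=; case: (boolP (odd N)) => oN /=.
  by rewrite mulr0 addr0 uphalf_half oN.
rewrite uphalf_half (negPf oN) add0n.
have -> : uphalf (N - true) = N./2 by lia.
rewrite /qpoch big_ord_recr /= -exprM mulNr opprK -exprS mulrDr mulr1.
by rewrite [_ * fpsX R ^+ _]mulrC mul2n (even_halfK oN).
Qed.

Lemma qpoch_unit (R : comUnitRingType) (a q : fps R) n :
  fcoef a 0 = 0 -> qpoch a q n \is a GRing.unit.
Proof.
move=> a0; apply: rpred_prod => i _.
change (fcoef (1 - a * q ^+ i) 0 \is a GRing.unit).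
by rewrite fcoefD fcoefN fcoefM big_ord1 a0 mul0r subr0 unitr1.
Qed.

(** For even [N+1] the inner sum telescopes to [A (N+1)] itself, so the recursion reads
    [(1 - q^(N+1)) A (N+1) = A N]; for odd [N+1] it vanishes. *)
Lemma part_gf (R : comUnitRingType) :
  part_gf_rec R false (fun N => (qpoch (fpsX R ^+ 2) (fpsX R ^+ 2) N./2)^-1).
Proof.
have X2 : fcoef (fpsX R ^+ 2) 0 = 0 by rewrite fcoef_exp_small.
elim=> [|N IH]; first by rewrite big_geq // addr0 /qpoch big_ord0 invr1.
rewrite big_nat_recr //= addrA -IH subn0.
rewrite (alternating_sum _ (fun k => (qpoch _ _ ((k - false)./2))^-1)); last first.
  by move=> j; rewrite !subn0 /= uphalf_double half_double.
rewrite subn0 /= negbK; case: (boolP (odd N)) => oN /=; last first.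
  by rewrite mulr0 addr0 uphalf_half (negPf oN).
rewrite uphalf_half oN add1n.
have := qpoch_unit R _ (fpsX R ^+ 2) N./2.+1 X2.
have uN := qpoch_unit R _ (fpsX R ^+ 2) N./2 X2.
rewrite /qpoch big_ord_recr /= -/(qpoch _ _ _) -exprS -exprM.
have -> : (2 * N./2.+1)%N = N.+1.
  by rewrite mul2n doubleS -[in RHS](odd_double_half N) oN.
rewrite unitrM uN /= => uF.
rewrite invrM //; apply: (mulrI uF); rewrite mulrA mulrV // mul1r.
by rewrite mulrDr [_ * (fpsX R ^+ _ * _)]mulrCA [_ * (_^-1 * _)]mulrA mulrV //; ring.
Qed.

(** * Passage to the limit *)

Lemma fps_cvgV (R : comUnitRingType) (u : nat -> fps R) (L : fps R) :
  (forall n, u n \is a GRing.unit) -> L \is a GRing.unit ->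
  fps_cvg u L -> fps_cvg (fun n => (u n)^-1) L^-1.
Proof.
move=> uU LU uL n.
(* One rank [M] serves all coefficients up to [n] at once. *)
have [M uM] : exists M, forall m i, (M <= m)%N -> (i <= n)%N ->
    fcoef (u m) i = fcoef L i.
  elim: n => [|n [M IH]].
    by have [M uM] := uL 0%N; exists M => m i /uM Mm; rewrite leqn0 => /eqP->.
  have [M' uM'] := uL n.+1; exists (maxn M M') => m i.
  rewrite geq_max => /andP[Mm M'm]; rewrite leq_eqVlt => /predU1P[->|].
    exact: uM'.
  by rewrite ltnS; apply: IH.
exists M => m Mm.
(* The error is a multiple of [L - u m], whose coefficients up to [n] vanish. *)
have -> : (u m)^-1 = L^-1 + (L - u m) * (L^-1 * (u m)^-1).
  by rewrite mulrBl mulrA mulrV // mul1r mulrCA mulrV // mulr1 addrC subrK.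
rewrite fcoefD fcoefM big1 ?addr0 // => i _.
by rewrite fcoefD fcoefN uM ?subrr ?mul0r // -ltnS.
Qed.

Lemma fps_cvg_comp (R : Type) (u : nat -> fps R) (L : fps R) (g : nat -> nat) :
  (forall M, exists N, forall n, (N <= n)%N -> (M <= g n)%N) ->
  fps_cvg u L -> fps_cvg (u \o g) L.
Proof.
move=> gP uL n; have [M uM] := uL n; have [N gN] := gP M.
by exists N => m /gN /uM.
Qed.

(** The largest part is at most [odd_sum], so for [N >= n] the bound [N] excludes no partition
    contributing to [q^n]. *)
Lemma part_sum_cvg (s : bool) (D : set (seq nat)) (A : nat -> fps int) L :
  let term p := (-1) ^+ even_sum p * fpsX int ^+ odd_sum p in
  (forall p, D p <-> is_part s p) -> part_gf_rec int s A -> fps_cvg A L ->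
  fps_summable D term /\ fps_sum D term = L.
Proof.
move=> term DP recA AL.
have termE p n : fcoef (term p) n = if odd_sum p == n then (-1) ^+ even_sum p else 0.
  rewrite /term fcoef_signM -[fpsX int ^+ _]mulr1 fcoefXnM fcoef1.
  case: ltngtP => [lt|gt|->]; rewrite ?mulr0 ?subnn ?mulr1 //.
  by rewrite subn_eq0 leqNgt lt mulr0.
clearbody term.
have enumP n N p : (n <= N)%N ->
    (p \in part_enum s n N n) = is_part s p && (odd_sum p == n).
  move=> nN; rewrite mem_part_enum //; case: eqP => [op|]; last by rewrite !andbF.
  by rewrite (leq_trans (head_le_odd_sum p)) ?op.
split=> [n|].
  apply: (@sub_finite_set _ _ [set` part_enum s n n n]%classic);
    last exact: finite_seq.
  move=> p [/DP pp]; rewrite /= enumP // pp termE.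
  by case: eqP.
apply/fpsP => n /=; have [M AM] := AL n.
(* At least [M], for the coefficient of [A] to be stable, and at least [n], for the enumeration to
   be complete. *)
rewrite -(AM (maxn M n)) ?leq_maxl //.
rewrite -(sum_part_enum int s A recA n) //.
have nN : (n <= maxn M n)%N by rewrite leq_maxr.
rewrite -(@fsbig_widen _ _ _ _ [set` part_enum s n (maxn M n) n]%classic D).
- rewrite -fsbig_seq; last exact: part_enum_uniq.
  apply: eq_big_seq => p; rewrite enumP // termE.
  by case/andP=> _ ->.
- by move=> p; rewrite /= enumP // => /andP[/DP].
- move=> p [/DP pp] /=; rewrite enumP // pp termE /=.
  by case: eqP.
Qed.

Theorem theorem4p1 :
  let q : fps int := fpsX int in
  let term (p : seq nat) : fps int := (-1) ^+ even_sum p * q ^+ odd_sum p in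
  (fps_summable distinct_partitions term
   /\ fps_sum distinct_partitions term = qpoch_inf (- q) (q ^+ 2))
  /\ (fps_summable partitions term
      /\ fps_sum partitions term = 1 / qpoch_inf (q ^+ 2) (q ^+ 2)).
Proof.
move=> q term.
have q0 : fcoef (q ^+ 2) 0 = 0 by rewrite fcoef_exp_small.
split.
  apply: (part_sum_cvg true _ _ _ distinct_partitionsE (distinct_part_gf int)).
  apply: (fps_cvg_comp _ _ _ uphalf _ (qpoch_cvg (- q) q0)) => M.
  by exists M.*2 => n; rewrite geq_uphalf_double => /leq_trans->.
rewrite div1r.
apply: (part_sum_cvg false _ _ _ partitionsE (part_gf int)).
apply: (fps_cvg_comp _ _ _ half _ (fps_cvgV _ _ _ _ _ (qpoch_cvg (q ^+ 2) q0))).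
- by move=> M; exists M.*2 => n; rewrite geq_half_double.
- by move=> n; apply: qpoch_unit.
- exact: qpoch_inf_unit.
Qed.
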